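(* For all nonnegative integers $n$, $p$ and every complex number $m$: $$\sum_{k=0}^n k^p H_{n-k}^{(m)} = H_n^{(-p)} H_n^{(m)} + \delta_{p,0} H_n^{(m)} + \frac{1}{p+1} \sum_{k=1}^{p+1} (-1)^k \binom{p+1}{k} \left[ B_{p-k+1}^+ + (p-k+1) H_n^{(k-p)} \right] H_n^{(m-k)}.$$
   Context: For a nonnegative integer $n$ and a complex number $m$, the generalized harmonic number is $H_n^{(m)} = \sum_{k=1}^n \frac{1}{k^m}$, where $k^m = e^{m\ln k}$ with the real logarithm for positive integers $k$. In particular $H_0^{(m)} = 0$ (empty sum), and $H_n^{(-p)} = \sum_{k=1}^n k^p$ for nonnegative integers $p$. The numbers $B_j^+$ ($j\ge 0$) are the Bernoulli numbers with the convention $B_1^+ = 1/2$, that is, $B_j^+ = (-1)^j B_j = B_j + \delta_{j,1}$, where $B_j$ are the Bernoulli numbers with $B_1=-1/2$ and $\delta$ is the Kronecker delta. The convention $0^0=1$ is used. *)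

(* Defs.v *)
From mathcomp Require Import all_boot all_order all_algebra.
From mathcomp Require Import reals sequences exp trigo.
From mathcomp Require Import complex.

Set Implicit Arguments.
Unset Strict Implicit.
Unset Printing Implicit Defensive.

Import Order.TTheory GRing.Theory Num.Theory.

Local Open Scope ring_scope.
Local Open Scope complex_scope.

(* e^(x + iy) = e^x (cos y + i sin y), as MathComp-Analysis only has the real
   exponential [expR]. *)
Definition cexp (R : realType) (z : R[i]) : R[i] :=
  let: x +i* y := z in (expR x)%:C * (cos y +i* sin y).

(* k^m = e^(m ln k) with the real logarithm; meaningful for k > 0 only
   ([ln 0 = 0], so [cpow_nat 0 m = 1]). *)
Definition cpow_nat (R : realType) (k : nat) (m : R[i]) : R[i] :=
  cexp (m * (ln (k%:R : R))%:C).

Definition gen_harmonic (R : realType) (n : nat) (m : R[i]) : R[i] :=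
  \sum_(1 <= k < n.+1) 1 / cpow_nat k m.

(* The list B_0, ..., B_(n-1), each entry being obtained from the previous ones
   by solving sum_(j <= n) 'C(n+1, j) B_j = [n = 0] for B_n. *)
Fixpoint bernoulli_seq (n : nat) : seq rat :=
  if n is n'.+1 then
    let s := bernoulli_seq n' in
    rcons s (((n' == 0%N)%:R - \sum_(j < n') 'C(n'.+1, j)%:R * s`_j)
             / n'.+1%:R)
  else [::].

(* Convention B_1 = - 1/2. *)
Definition bernoulli_number (n : nat) : rat := (bernoulli_seq n.+1)`_n.

Lemma size_bernoulli_seq n : size (bernoulli_seq n) = n.
Proof. by elim: n => //= n IHn; rewrite size_rcons IHn. Qed.

Lemma nth_bernoulli_seq n j : (j < n)%N -> (bernoulli_seq n)`_j = bernoulli_number j.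
Proof.
elim: n => // n IHn; rewrite ltnS leq_eqVlt => /predU1P[->//|ltjn].
by rewrite /= nth_rcons size_bernoulli_seq ltjn IHn.
Qed.

Lemma bernoulli_rec n :
  \sum_(j < n.+1) 'C(n.+1, j)%:R * bernoulli_number j = (n == 0%N)%:R.
Proof.
rewrite big_ord_recr /= {2}/bernoulli_number /= nth_rcons size_bernoulli_seq ltnn eqxx.
rewrite binSn mulrC divfK ?pnatr_eq0// addrC.
under [X in _ - X]eq_bigr => j _ do rewrite nth_bernoulli_seq//.
by rewrite subrK.
Qed.

Lemma bernoulli1 : bernoulli_number 1 = - (1 / 2%:R).
Proof.
have := bernoulli_rec 1; rewrite big_ord_recr big_ord1 /=.
have -> : bernoulli_number 0 = 1.
  by have := bernoulli_rec 0; rewrite big_ord1 bin0 mul1r.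
rewrite bin0 bin1 mul1r => /eqP; rewrite addrC addr_eq0 => /eqP B1.
by apply: (@mulfI _ 2%:R) => //; rewrite B1.
Qed.

(* Convention B_1 = + 1/2. *)
Definition bernoulli_plus (n : nat) : rat := bernoulli_number n + (n == 1%N)%:R.

(* Main.v *)
Require Import Defs.
From mathcomp Require Import all_boot all_order all_algebra.
From mathcomp Require Import reals sequences exp trigo.
From mathcomp Require Import complex.
From mathcomp Require Import ring zify.

Set Implicit Arguments.
Unset Strict Implicit.
Unset Printing Implicit Defensive.

Import Order.TTheory GRing.Theory Num.Theory.

Local Open Scope ring_scope.
Local Open Scope complex_scope.

(* Exchanging summations, the left-hand side is the sum over 1 <= j <= n of
   j^(-m) times the sum of the p-th powers of 0, ..., n - j.  By Faulhaber's
   formula the latter is a polynomial in n - j, expressed through the Appell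
   sequence P_q(x) = sum_i 'C(q, i) B_i^+ x^(q - i).  The Appell identity
   P_q(n - j) = sum_k 'C(q, k) (- j)^k P_(q - k)(n) expands it in powers of j,
   and Faulhaber's formula, read backwards, turns each P_(q - k)(n) into
   B_(q - k)^+ + (q - k) H_n^(1 - q + k). *)

(** For [i + k <= q] both products are the trinomial coefficient [q! / (i! k! (q - i - k)!)];
    otherwise both vanish. *)
Lemma mul_bin_bin (q i k : nat) :
  ('C(q, i) * 'C(q - i, k) = 'C(q, k) * 'C(q - k, i))%N.
Proof.
have bin_trinomial a b : (a + b <= q)%N ->
    ('C(q, a) * 'C(q - a, b) * (a`! * b`! * (q - a - b)`!) = q`!)%N.
  move=> abq; have aq : (a <= q)%N by lia.
  have bqa : (b <= q - a)%N by lia.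
  by rewrite -(bin_fact aq) -(bin_fact bqa); ring.
have [ikq|qik] := leqP (i + k) q; last first.
  have [iq|qi] := ltnP q i; have [kq|qk] := ltnP q k;
    by rewrite ?(bin_small iq) ?(bin_small kq) ?mul0n ?(@bin_small (q - i) k)
       ?(@bin_small (q - k) i) ?muln0 //; lia.
apply/eqP; rewrite -(@eqn_pmul2r (i`! * k`! * (q - i - k)`!)) ?muln_gt0 ?fact_gt0 //.
rewrite bin_trinomial // [(i`! * _)%N]mulnC subnAC bin_trinomial //; lia.
Qed.

Section Appell.
Variable A : comNzRingType.
Implicit Types (a : nat -> A) (x y : A).

Definition appell_poly a (q : nat) x : A :=
  \sum_(i < q.+1) 'C(q, i)%:R * a i * x ^+ (q - i).

(** The added terms vanish with ['C(q, i)]. A range independent of the degree allows the exchange of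
    sums in [appell_polyD]. *)
Lemma appell_poly_widen a q r x : (q <= r)%N ->
  appell_poly a q x = \sum_(i < r.+1) 'C(q, i)%:R * a i * x ^+ (q - i).
Proof.
move=> qr; rewrite /appell_poly.
rewrite (big_ord_widen r.+1 (fun i => 'C(q, i)%:R * a i * x ^+ (q - i))) //.
rewrite big_mkcond; apply: eq_bigr => i _; rewrite ltnS leqNgt.
by case: ifPn => //; rewrite negbK => /bin_small ->; rewrite !mul0r.
Qed.

Lemma appell_polyD a q x y :
  appell_poly a q (x + y) =
  \sum_(k < q.+1) 'C(q, k)%:R * y ^+ k * appell_poly a (q - k) x.
Proof.
under [RHS]eq_bigr => k _ do
  rewrite (appell_poly_widen _ _ (leq_subr k q)) mulr_sumr.
rewrite exchange_big; apply: eq_bigr => i _ /=.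
rewrite exprDn (big_ord_widen q.+1
  (fun k => x ^+ (q - i - k) * y ^+ k *+ 'C(q - i, k))); last by lia.
rewrite big_mkcond mulr_sumr; apply: eq_bigr => k _.
have -> : (if (k < (q - i).+1)%N then x ^+ (q - i - k) * y ^+ k *+ 'C(q - i, k)
           else 0) = x ^+ (q - i - k) * y ^+ k * 'C(q - i, k)%:R.
  rewrite mulr_natr; case: ifPn => //; rewrite -leqNgt => /bin_small ->.
  by rewrite mulr0n.
have := congr1 (fun t => t%:R : A) (mul_bin_bin q i k).
rewrite !natrM subnAC => E.
transitivity ('C(q, i)%:R * 'C(q - i, k)%:R * a i * x ^+ (q - k - i) * y ^+ k).
  by ring.
by rewrite E; ring.
Qed.

Lemma appell_poly0 a q : appell_poly a q 0 = a q.
Proof.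
rewrite /appell_poly big_ord_recr /= subnn binn mul1r expr0 mulr1.
rewrite big1 ?add0r // => i _.
by rewrite expr0n subn_eq0 leqNgt ltn_ord /= mulr0.
Qed.

End Appell.

Section Faulhaber.
Variable F : numFieldType.

Let b (i : nat) : F := ratr (bernoulli_number i).
Let bp (i : nat) : F := ratr (bernoulli_plus i).

(** The top term is [b q]; for [q > 0] the others sum to [[q = 1]] by the recurrence defining the
    Bernoulli numbers. *)
Lemma appell_bernoulli1 q :
  appell_poly b q 1 = b q + (q == 1%N)%:R.
Proof.
rewrite /appell_poly big_ord_recr /= binn mul1r expr1n mulr1 addrC; congr +%R.
case: q => [|q]; first by rewrite big_ord0.
have := congr1 (@ratr F) (bernoulli_rec q).
rewrite rmorph_nat rmorph_sum /= eqSS => <-.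
by apply: eq_bigr => i _; rewrite expr1n mulr1 rmorphM /= ratr_nat.
Qed.

(** Expanding around 1, with increment [x], brings in the values at 1. Their Kronecker correction
    survives only for [q - k = 1], where it gives the power term. *)
Lemma appell_bernoulliD1 q x :
  appell_poly b q (x + 1) = appell_poly b q x + q%:R * x ^+ q.-1.
Proof.
rewrite addrC appell_polyD.
under eq_bigr => k _ do rewrite appell_bernoulli1 mulrDr.
rewrite big_split /=; congr +%R.
  rewrite /appell_poly [RHS](reindex_inj rev_ord_inj) /=.
  apply: eq_bigr => k _; rewrite subSS bin_sub ?subKn -1?ltnS //.
  by rewrite mulrAC.
case: q => [|q]; first by rewrite big_ord1 /= mulr0 mul0r.
rewrite big_ord_recr /= subnn mulr0 addr0 big_ord_recr /= subSnn mulr1 big1.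
  by rewrite add0r binSn.
move=> k _; rewrite (_ : (_ == _) = false) ?mulr0 //.
by apply/eqP => /=; have := ltn_ord k; lia.
Qed.

(** Changing the sign of [B_1] only adds [q x^(q-1)], which is the forward difference of the
    polynomial built on [b]. *)
Lemma appell_bernoulli_plus q x :
  appell_poly bp q x = appell_poly b q (x + 1).
Proof.
rewrite appell_bernoulliD1 /appell_poly.
under eq_bigr => k _ do rewrite /bp rmorphD /= rmorph_nat mulrDr mulrDl.
rewrite big_split /=; congr +%R.
case: q => [|q]; first by rewrite big_ord1 /= mulr0 !mul0r.
rewrite !big_ord_recl /= mulr0 mul0r add0r big1 ?addr0.
  by rewrite mulr1 bin1 subSS subn0.
by move=> i _; rewrite mulr0 mul0r.
Qed.

(** Telescoping: the step from [N] to [N + 1] on the left is a forward difference of the polynomial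
    built on [b], taken at [N + 1]. *)
Lemma faulhaber q N :
  appell_poly bp q N%:R =
  bp q + q%:R * \sum_(1 <= k < N.+1) k%:R ^+ q.-1.
Proof.
elim: N => [|N IH]; first by rewrite big_geq // appell_poly0 mulr0 addr0.
rewrite big_nat_recr //= mulrDr addrA -IH !appell_bernoulli_plus.
by rewrite -[N.+1]addn1 natrD -appell_bernoulliD1.
Qed.

Lemma sum_pow_sub p n j : (j <= n)%N ->
  \sum_(1 <= k < (n - j).+1) k%:R ^+ p =
  \sum_(1 <= k < n.+1) k%:R ^+ p + 1 / p.+1%:R *
    \sum_(1 <= k < p.+2) (-1) ^+ k * 'C(p.+1, k)%:R
      * (bp (p.+1 - k)
         + (p.+1 - k)%:R * \sum_(1 <= i < n.+1) i%:R ^+ (p - k))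
      * j%:R ^+ k :> F.
Proof.
move=> jn; have p1 : p.+1%:R != 0 :> F by rewrite pnatr_eq0.
apply: (mulfI p1); rewrite mulrDr mulrA mul1r mulfV // mul1r.
(* The added constant completes the left side to a Faulhaber value at [n - j]. In its expansion with
   increment [- j], the term [k = 0] yields this constant and the full power sum. *)
apply: (addrI (bp p.+1)); rewrite -(faulhaber p.+1) natrB // appell_polyD.
rewrite big_ord_recl /= bin0 subn0 expr0 !mul1r faulhaber addrA; congr +%R.
rewrite big_add1 /= big_mkord; apply: eq_bigr => k _; rewrite /bump /= add1n.
rewrite faulhaber -subn1 -subnDA addnC subnDA subn1 /=.
by rewrite -mulN1r exprMn; ring.
Qed.

End Faulhaber.

Section ComplexPower.
Variable R : realType.
Implicit Types (z w m : R[i]).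

Lemma cexpD z w : cexp (z + w) = cexp z * cexp w.
Proof.
case: z w => [a c] [a' c'] /=; rewrite expRD cosD sinD.
by apply/eqP; rewrite eq_complex /=; apply/andP; split; apply/eqP; ring.
Qed.

Lemma cexp_real (x : R) : cexp x%:C = (expR x)%:C.
Proof. by rewrite /= cos0 sin0 mulr1. Qed.

Lemma cpow_natD k m j : (0 < k)%N ->
  cpow_nat k (m + j%:R) = cpow_nat k m * k%:R ^+ j.
Proof.
move=> k0; rewrite /cpow_nat mulrDl cexpD; congr *%R.
rewrite -(rmorph_nat (real_complex R)) -rmorphM cexp_real [j%:R * _]mulrC.
by rewrite expRM_natr lnK ?posrE ?ltr0n // rmorphXn rmorph_nat.
Qed.

Lemma cpow_natBV k m j : (0 < k)%N ->
  1 / cpow_nat k (m - j%:R) = 1 / cpow_nat k m * k%:R ^+ j.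
Proof.
(* Writing [m] as [(m - j) + j] leaves only [k ^+ j] to cancel, so only this factor must be shown
   nonzero. *)
move=> k0; rewrite -[in RHS](subrK j%:R m) cpow_natD // !mul1r invfM mulfVK //.
by rewrite expf_neq0 // pnatr_eq0 -lt0n.
Qed.

Lemma gen_harmonicB n m j :
  gen_harmonic n (m - j%:R) =
  \sum_(1 <= k < n.+1) 1 / cpow_nat k m * k%:R ^+ j.
Proof. by apply: eq_big_nat => k /andP[k0 _]; rewrite cpow_natBV. Qed.

Lemma gen_harmonicN n p :
  gen_harmonic n (- p%:R) = \sum_(1 <= k < n.+1) k%:R ^+ p :> R[i].
Proof.
rewrite -sub0r gen_harmonicB; apply: eq_bigr => k _.
by rewrite /cpow_nat mul0r (cexp_real 0) expR0 rmorph1 divr1 mul1r.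
Qed.

(** Both sides sum over the triangle [j + k <= n] with [j >= 1]; the dependent bounds become
    conditions on a fixed range before the exchange. *)
Lemma sum_mul_gen_harmonic (f : nat -> R[i]) n m :
  \sum_(0 <= k < n.+1) f k * gen_harmonic (n - k)%N m =
  \sum_(1 <= j < n.+1) 1 / cpow_nat j m * \sum_(0 <= k < (n - j).+1) f k.
Proof.
rewrite /gen_harmonic.
under eq_bigr => k _ do
  rewrite mulr_sumr (big_nat_widen _ _ n.+1) ?ltnS ?leq_subr //.
rewrite (exchange_big_dep_nat xpredT) //=; apply: eq_big_nat => j /andP[j0 jn].
rewrite mulr_sumr [RHS](big_nat_widen _ _ n.+1) ?ltnS ?leq_subr //.
rewrite big_nat_cond [RHS]big_nat_cond; apply: eq_big => k; last by rewrite mulrC.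
by rewrite /=; lia.
Qed.

End ComplexPower.

Theorem theorem3p3 (R : realType) (n p : nat) (m : R[i]) :
  \sum_(0 <= k < n.+1) k%:R ^+ p * gen_harmonic (n - k)%N m
  = gen_harmonic n (- p%:R) * gen_harmonic n m + (p == 0%N)%:R * gen_harmonic n m
    + 1 / p.+1%:R *
      \sum_(1 <= k < p.+2)
         (-1) ^+ k * 'C(p.+1, k)%:R
         * (ratr (bernoulli_plus (p.+1 - k)%N)
            + (p.+1 - k)%N%:R * gen_harmonic n (k%:R - p%:R))
         * gen_harmonic n (m - k%:R).
Proof.
rewrite sum_mul_gen_harmonic gen_harmonicN.
under eq_big_nat => j /andP[j0 jn].
  (* The term [0 ^+ p] is 1 exactly when [p = 0]: it is the source of the Kronecker delta. *)
  rewrite big_ltn // expr0n sum_pow_sub //.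
  rewrite (mulrDr (1 / cpow_nat j m)) (mulrDr (1 / cpow_nat j m)).
  over.
rewrite !big_split /= -!mulr_suml -/(gen_harmonic n m) addrA.
congr +%R; first by rewrite addrC mulrC; congr +%R; rewrite mulrC.
under eq_bigr => j _ do rewrite mulrCA [X in _ * X]mulr_sumr.
rewrite -mulr_sumr exchange_big /=; congr *%R.
apply: eq_big_nat => k /andP[k0 kp]; rewrite gen_harmonicB [RHS]mulr_sumr.
apply: eq_bigr => j _; rewrite [LHS]mulrCA; congr (_ * (_ + _) * _).
(* At [k = p + 1] the truncated exponent [p - k] differs from the true one, but the factor
   [p + 1 - k] is 0 on both sides. *)
move: kp; rewrite ltnS leq_eqVlt => /predU1P[->|kp].
  by rewrite subnn !mul0r.
by rewrite -opprB -natrB // gen_harmonicN.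
Qed.
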